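(* There exists an infinite family of instances of the problem $\min\{f(\mathbf{x}) : \mathbf{x}\in P\cap\mathbb{Z}^2\}$, with $P\subseteq\mathbb{R}^2$ a rational polyhedron and $f$ a homogeneous polynomial of degree $4$ in two variables with integer coefficients, such that the minimal size optimal solution of the instance has size exponential in the input size.
   Context: An instance is given by $A\in\mathbb{Z}^{m\times 2}$, $\mathbf{b}\in\mathbb{Z}^m$ defining $P=\{\mathbf{x}\in\mathbb{R}^2 : A\mathbf{x}\le\mathbf{b}\}$, and by the integer coefficients of $f$. Size means binary encoding length; the input size is the total binary encoding length of $A$, $\mathbf{b}$ and the coefficients of $f$, and the size of a solution $\mathbf{x}\in\mathbb{Z}^2$ is the binary encoding length of its coordinates. A polynomial is homogeneous of degree $d$ if all its monomials have total degree exactly $d$. ''Exponential in the input size'' means that, over the family, the smallest size of an optimal solution is $\Omega(c^{s})$ for some constant $c>1$, where $s$ is the input size of the instance (and $s$ is unbounded over the family). *)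

(* Defs.v *)
From HB Require Import structures.
From mathcomp Require Import all_boot all_order all_algebra.
From mathcomp Require Import reals.
From mathcomp Require Import mpoly.

Set Implicit Arguments.
Unset Strict Implicit.
Unset Printing Implicit Defensive.

Import Order.TTheory GRing.Theory Num.Theory.
Local Open Scope ring_scope.

Record instance (d : nat) := Instance {
  nb_rows : nat;
  constr_mx : 'M[int]_(nb_rows, 2);
  constr_rhs : 'cV[int]_nb_rows;
  objective : {mpoly int[2]};
  objective_homog : objective \is d.-homog
}.

Definition polyhedron (R : realType) (m : nat) (A : 'M[int]_(m, 2))
    (b : 'cV[int]_m) (x : 'cV[R]_2) : Prop :=
  forall i : 'I_m, (map_mx intr A *m x) i 0 <= (b i 0)%:~R.

Definition feasible (R : realType) (d : nat) (I : instance d)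
    (x : 'cV[int]_2) : Prop :=
  polyhedron (constr_mx I) (constr_rhs I) (map_mx intr x : 'cV[R]_2).

Definition objective_value (d : nat) (I : instance d) (x : 'cV[int]_2) : int :=
  (objective I).@[fun i => x i 0].

Definition optimal (R : realType) (d : nat) (I : instance d)
    (x : 'cV[int]_2) : Prop :=
  feasible R I x /\
  forall y, feasible R I y -> objective_value I x <= objective_value I y.

(* One sign bit plus ceil(log2(|z| + 1)) binary digits. *)
Definition int_size (z : int) : nat := (up_log 2 `|z|.+1).+1.

Definition point_size (x : 'cV[int]_2) : nat :=
  (\sum_i int_size (x i ord0))%N.

(* Dense encoding of a binary form of degree d by its d + 1 coefficients,
   those of X_0^(d - i) X_1^i for i = 0, ..., d, zero ones included. *)
Definition form_size (d : nat) (f : {mpoly int[2]}) : nat :=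
  (\sum_(i < d.+1) int_size f@_[multinom [tuple (d - i)%N; nat_of_ord i]])%N.

Definition input_size (d : nat) (I : instance d) : nat :=
  (\sum_i \sum_j int_size (constr_mx I i j)
   + \sum_i int_size (constr_rhs I i ord0)
   + form_size d (objective I))%N.

Definition minimal_size_optimal (R : realType) (d : nat) (I : instance d)
    (x : 'cV[int]_2) : Prop :=
  optimal R I x /\ forall y, optimal R I y -> (point_size x <= point_size y)%N.

(* Main.v *)
Require Import Defs.
From mathcomp Require Import all_boot all_order all_algebra.
From mathcomp Require Import boolp reals mpoly.
From mathcomp Require Import ring lra zify.

Set Implicit Arguments.
Unset Strict Implicit.
Unset Printing Implicit Defensive.

Import Order.TTheory GRing.Theory Num.Theory.

(** Minimize [(x^2 - 2 (2^k y)^2)^2] over the integer points with [y >= 1].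
    Since 2 is not a rational square the objective never vanishes there, so its
    minimum is 1 as soon as [x^2 - 2 (2^k y)^2 = 1] or [-1] is solvable, and then
    the optimal solutions are exactly the solutions of these two equations
    ([optimal_pell_instance]).

    The coefficients have [O(k)] digits, and the input size is [6 k + 17].  The
    optimal solutions correspond, through [X = x] and [Y = 2^k y], to the units
    [X + Y sqrt 2] of [Z[sqrt 2]] with [Y > 0] divisible by [2^k].
    These are all powers of [1 + sqrt 2] up to sign and conjugation, and [2^k]
    divides the second coordinate of the [j]-th power only if it divides [j]; so
    such a unit has at least about [2^k] digits.

    The proof of this last fact ([pell_lower_bound]) avoids the structure of the
    unit group: a solution with even [Y] is the square of a smaller solution
    [(a, b)], in the sense that [Y = 2 a b] with [a] odd ([pell_even_descent]).
    Iterating [k] times shows that [2 Y] is at least [2 ^ (2 ^ k)].  In the other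
    direction, squaring [1 + sqrt 2] repeatedly gives a solution for every [k]
    ([pell_exists]). *)

(** * Pell solutions with a highly 2-divisible coordinate *)

(** Both signs are allowed: these are the coordinates of the units
    [x + y sqrt 2] of [Z[sqrt 2]], up to sign. *)
Definition pell (x y : nat) : bool :=
  (x ^ 2 == 2 * y ^ 2 + 1) || (x ^ 2 + 1 == 2 * y ^ 2).

Lemma pell_odd x y : pell x y -> odd x.
Proof. by case/orP=> /eqP e; have: odd (x ^ 2) || odd (x ^ 2 + 1) ; nia. Qed.

Lemma pell_geq x y : 0 < y -> pell x y -> y <= x.
Proof. move=> y0 /orP[] /eqP; nia. Qed.

(** Expand [gcd(u, z)^2] as [gcd(u^2, u z, z^2) = u gcd(u, z, w)]; the last gcd
    is 1 by coprimality. *)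
Lemma gcdn_sqr_factor u w z : coprime u w -> u * w = z ^ 2 -> gcdn u z ^ 2 = u.
Proof.
move=> cuw e; rewrite -mulnn muln_gcdr !muln_gcdl [z * z]mulnn -e [z * u]mulnC.
rewrite -!muln_gcdr -[RHS]muln1; congr (_ * _).
by apply/eqP; rewrite -/(coprime _ _) (coprime_dvdl (dvdn_gcdl _ _)) //
   (coprime_dvdr (dvdn_gcdr _ _)).
Qed.

Lemma coprime_mul_sqr u w z : coprime u w -> u * w = z ^ 2 ->
  exists a b, [/\ u = a ^ 2, w = b ^ 2 & z = a * b].
Proof.
move=> cuw e; exists (gcdn u z), (gcdn w z).
have hu := gcdn_sqr_factor cuw e.
have hw : gcdn w z ^ 2 = w.
  by apply: (@gcdn_sqr_factor _ u); rewrite 1?coprime_sym 1?mulnC.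
split=> //; apply/eqP; rewrite -(@eqn_exp2r _ _ 2) // expnMn hu hw e //.
Qed.

(** Extraction of a square root in the unit group, without knowing that group.
    If [y = 2 z] then reduction modulo 4 forces [x^2 = 2 y^2 + 1]; with
    [x = 2 u + 1] this reads [u (u + 1) = 2 z^2].  Of the coprime numbers [u] and
    [u + 1], the even one is therefore twice a square and the odd one a square,
    and being consecutive they form a solution again.  The parity of [u] decides
    the sign of the new solution. *)
Lemma pell_even_descent x y : pell x y -> 2 %| y ->
  exists a b, pell a b /\ y = 2 * (a * b).
Proof.
move=> p /dvdnP[z ez]; have ox := pell_odd p.
have [u eu] : exists u, x = 2 * u + 1 by exists (x./2); lia.
have e : u * (u + 1) = 2 * z ^ 2 by subst; case/orP: p => /eqP; nia.
have [[w ew]|[w ew]] : (exists w, u = 2 * w) \/ (exists w, u = 2 * w + 1).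
- by case: (boolP (odd u)) => o; [right|left]; exists u./2; lia.
- have c : coprime w (2 * w + 1).
    by have := coprimenS (2 * w); rewrite coprimeMl addn1 => /andP[].
  have [|b [a [eb ea zab]]] := @coprime_mul_sqr _ _ z c; first by subst; nia.
  by exists a, b; split; [rewrite /pell; lia | lia].
- have c : coprime (2 * w + 1) (w + 1).
    have := coprimenS (2 * w + 1); have -> : (2 * w + 1).+1 = 2 * (w + 1) by lia.
    by rewrite coprimeMr => /andP[].
  have [|a [b [ea eb zab]]] := @coprime_mul_sqr _ _ z c; first by subst; nia.
  by exists a, b; split; [rewrite /pell; lia | lia].
Qed.

(** Each descent step [y = 2 a b] removes exactly one factor 2 from [y], since
    [a] is odd, and at least halves the number of digits, since [b <= a] gives
    [2 y >= (2 b)^2].  So [k] factors 2 force [2 ^ k] digits. *)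
Lemma pell_lower_bound k x y : pell x y -> 0 < y -> 2 ^ k %| y -> 2 ^ (2 ^ k) <= 2 * y.
Proof.
elim: k x y => [|k IH] x y p y0 d; first by rewrite expn1; lia.
have [|a [b [q e]]] := pell_even_descent p.
  by apply: dvdn_trans d; rewrite expnS dvdn_mulr.
have b0 : 0 < b by nia.
have db : 2 ^ k %| b.
  move: d; rewrite e expnS dvdn_pmul2l // Gauss_dvdr // coprimeXl //.
  by rewrite coprime2n (pell_odd q).
have leba := pell_geq b0 q.
have := IH _ _ q b0 db; rewrite -(@leq_exp2r _ _ 2) // => h.
rewrite expnS mulnC expnM e; apply: leq_trans h _; nia.
Qed.

(** Squaring the unit [a + b sqrt 2] replaces [b] by [2 a b]. *)
Lemma pell_exists k : exists x y, [/\ pell x y, 0 < y & 2 ^ k %| y].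
Proof.
elim: k => [|k [a [b [p b0 d]]]]; first by exists 1, 1.
exists (a ^ 2 + 2 * b ^ 2), (2 * (a * b)); split.
- by case/orP: p => /eqP e; apply/orP; left; apply/eqP; nia.
- by have := pell_odd p; case: a p => // a *; lia.
- by rewrite expnS dvdn_pmul2l // dvdn_mull.
Qed.

(** Irrationality of the square root of 2: the 2-adic valuations of the two
    sides have different parities. *)
Lemma sqr_neq_double_sqr x y : 0 < y -> x ^ 2 != 2 * y ^ 2.
Proof.
move=> y0; apply/eqP=> e.
have x0 : 0 < x by nia.
have /= := congr1 (logn 2) e.
by rewrite lognM ?expn_gt0 ?y0 // !lognX (@logn_prime 2 2) //= ; lia.
Qed.

Local Open Scope ring_scope.

(** * Binary forms given by their coefficients *)

Definition binary_mnm (d i : nat) : 'X_{1..2} :=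
  [multinom [tuple (d - i)%N; i]].

Definition binary_form (d : nat) (c : nat -> int) : {mpoly int[2]} :=
  \sum_(i < d.+1) c i *: 'X_[binary_mnm d i].

Lemma binary_form_homog d c : binary_form d c \is d.-homog.
Proof.
apply: rpred_sum => i _; apply: dhomogZ; rewrite dhomogX /= mdegE.
by rewrite !big_ord_recl big_ord0 !mnm_tnth /= addn0 subnK // -ltnS.
Qed.

Lemma form_size_binary_form d c :
  form_size d (binary_form d c) = (\sum_(i < d.+1) int_size (c i))%N.
Proof.
apply: eq_bigr => i _; rewrite -/(binary_mnm d i) raddf_sum /= (bigD1 i) //=.
rewrite mcoeffZ mcoeffX eqxx mulr1 big1 ?addr0 // => j neq_ji.
rewrite mcoeffZ mcoeffX; case: eqP => [e|_]; last by rewrite mulr0.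
have := congr1 (fun m : 'X_{1..2} => m ord_max) e; rewrite !mnm_tnth => e'.
by case/eqP: neq_ji; apply: val_inj.
Qed.

Lemma meval_binary_form d c (v : 'I_2 -> int) :
  (binary_form d c).@[v] =
  \sum_(i < d.+1) c i * (v 0 ^+ (d - i) * v 1 ^+ i).
Proof.
rewrite raddf_sum; apply: eq_bigr => i _; rewrite /= mevalZ mevalX.
rewrite !big_ord_recl big_ord0 !mnm_tnth /= mulr1.
by congr (_ * (_ * v _ ^+ _)); apply: val_inj.
Qed.

(** * The family of instances *)

(** Coefficients of the expanded form of [(X^2 - 2 (2^k Y)^2)^2]. *)
Definition pell_coef (k i : nat) : int :=
  nth 0 [:: 1; 0; - (2 ^ (2 * k + 2))%:Z; 0; (2 ^ (4 * k + 2))%:Z] i.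

(** The single constraint [- y <= -1] excludes the small point [(1, 0)], and the
    origin, where the form vanishes. *)
Definition pell_instance (k : nat) : instance 4 :=
  Instance (\row_j if j == 0 then 0 else -1) (const_mx (-1))
    (binary_form_homog 4 (pell_coef k)).

Lemma int_size_pow2 n : int_size (2 ^ n)%:Z = n.+2.
Proof.
rewrite /int_size absz_nat (@up_log_eq _ n) // leqnn /= expnS mul2n -addnn.
by rewrite -addn1 leq_add2l expn_gt0.
Qed.

Lemma int_sizeN z : int_size (- z) = int_size z.
Proof. by rewrite /int_size abszN. Qed.

Lemma input_size_pell_instance k : input_size (pell_instance k) = (6 * k + 17)%N.
Proof.
rewrite /input_size /= form_size_binary_form !big_ord1 !big_ord_recl !big_ord0.
rewrite !mxE /= /pell_coef /= int_sizeN !int_size_pow2.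
have -> : int_size 0 = 1%N by rewrite /int_size absz0 up_log1.
have e1 : int_size 1 = 2 by rewrite (int_size_pow2 0).
by rewrite int_sizeN e1; lia.
Qed.

Lemma feasible_pell_instance (R : realType) k x :
  feasible R (pell_instance k) x <-> 0 < x 1 0.
Proof.
have E : (map_mx intr (constr_mx (pell_instance k)) *m
            (map_mx intr x : 'cV[R]_2)) 0 0 = - (x 1 0)%:~R.
  rewrite mxE !big_ord_recl big_ord0 !mxE /= mul0r add0r addr0 rmorphN mulN1r.
  by congr (- (x _ _)%:~R); apply: val_inj.
have le_iff :
  (- (x 1 0)%:~R <= (constr_rhs (pell_instance k) 0 0)%:~R :> R) = (0 < x 1 0).
  by rewrite mxE rmorphN lerN2 ler_int gtz0_ge1.
split=> [/(_ 0)|x1 i]; first by rewrite E le_iff.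
by rewrite ord1 E le_iff.
Qed.

Lemma objective_value_pell_instance k x :
  objective_value (pell_instance k) x =
  (`|(x 0 0)%R|%N%:Z ^+ 2 - 2 * (2 ^ k * `|(x 1 0)%R|)%N%:Z ^+ 2) ^+ 2.
Proof.
rewrite /objective_value meval_binary_form !big_ord_recl big_ord0 /pell_coef /=.
rewrite /bump /= !add1n subn0 !subSS.
have pow2 n : (2 ^ n)%:Z = 2 ^+ n by rewrite -natz natrX.
rewrite PoszM !abszE exprMn !real_normK ?num_real // !pow2.
rewrite (exprD _ (2 * k)) (exprD _ (4 * k)) (mulnC 2) (mulnC 4) !(exprM 2 k).
ring.
Qed.

Lemma point_size_geq (x : 'cV[int]_2) n :
  (2 ^ n <= absz (x ord0 ord0))%N -> (n < point_size x)%N.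
Proof.
move=> h; rewrite /point_size big_ord_recl /int_size.
have: (2 ^ n < 2 ^ up_log 2 `|x ord0 ord0|.+1)%N.
  by apply: leq_trans (up_logP _ _).
by rewrite ltn_exp2l //; lia.
Qed.

(** The input size is [6 k + 17], so any base with sixth power at most 2 works;
    the factor 1/8 absorbs the seventeen remaining powers. *)
Lemma exp_input_size_bound (R : realType) k :
  (1 / 8) * (11 / 10) ^+ (6 * k + 17) <= 2 ^+ k :> R.
Proof.
have h6 : (11 / 10) ^+ 6 <= 2 :> R by lra.
have h17 : (1 / 8) * (11 / 10) ^+ 17 <= 1 :> R by lra.
rewrite exprD exprM mulrCA.
have h : ((11 / 10) ^+ 6) ^+ k <= 2 ^+ k :> R.
  by apply: lerXn2r; rewrite ?nnegrE ?h6 // exprn_ge0 //; lra.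
apply: le_trans h; rewrite -[leRHS]mulr1; apply: ler_wpM2l => //.
by rewrite !exprn_ge0 //; lra.
Qed.

(** * Optimal solutions and their size *)

Lemma objective_value_pell_gt0 k (x : 'cV[int]_2) :
  0 < x 1 0 -> 0 < objective_value (pell_instance k) x.
Proof.
move=> y0; rewrite objective_value_pell_instance lt0r sqr_ge0 andbT expf_eq0 /=.
have y1 : (0 < 2 ^ k * `|(x 1 0)%R|)%N.
  by rewrite muln_gt0 expn_gt0 absz_gt0 (gt_eqF y0).
have := sqr_neq_double_sqr `|(x 0 0)%R| y1; lia.
Qed.

Lemma objective_value_pell_eq1 k (x : 'cV[int]_2) :
  objective_value (pell_instance k) x = 1 <->
  pell `|(x 0 0)%R| (2 ^ k * `|(x 1 0)%R|).
Proof.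
rewrite objective_value_pell_instance /pell.
set u := `|(x 0 0)%R|%N; set v := (_ * _)%N.
split=> [/eqP|]; last by case/orP=> /eqP h; apply/eqP; rewrite sqrf_eq1; lia.
rewrite sqrf_eq1 => h; apply/orP; lia.
Qed.

Lemma pell_instance_point k : exists x : 'cV[int]_2,
  0 < x 1 0 /\ pell `|(x 0 0)%R| (2 ^ k * `|(x 1 0)%R|).
Proof.
have [a [b [p b0 /dvdnP[c e]]]] := pell_exists k.
exists (\col_i if i == 0 then a%:Z else c%:Z).
rewrite !mxE /= mulnC -e; split=> //; nia.
Qed.

(** The objective is the square of an integer that is nonzero on the feasible
    set, so the value 1 is a lower bound; it is the minimum because it is
    attained. *)
Lemma optimal_pell_instance (R : realType) k x :
  optimal R (pell_instance k) x <->
  0 < x 1 0 /\ pell `|(x 0 0)%R| (2 ^ k * `|(x 1 0)%R|).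
Proof.
split=> [[/feasible_pell_instance y0 opt]|[y0 p]].
- split=> //; apply/objective_value_pell_eq1/eqP.
  rewrite eq_le -gtz0_ge1 objective_value_pell_gt0 // andbT.
  have [z [z1 /objective_value_pell_eq1 <-]] := pell_instance_point k.
  by apply: opt; apply/feasible_pell_instance.
- split=> [|z /feasible_pell_instance z1]; first exact/feasible_pell_instance.
  by rewrite ((objective_value_pell_eq1 _ _).2 p) -gtz0_ge1 objective_value_pell_gt0.
Qed.

Lemma optimal_pell_instance_size (R : realType) k x :
  optimal R (pell_instance k) x -> (2 ^ k <= point_size x)%N.
Proof.
case/optimal_pell_instance=> y0 p.
have Y0 : (0 < 2 ^ k * `|(x 1 0)%R|)%N.
  by rewrite muln_gt0 expn_gt0 absz_gt0 (gt_eqF y0).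
have lb := pell_lower_bound p Y0 (dvdn_mulr _ (dvdnn _)).
(* The bound on [2 y] gives [2 ^ (2 ^ k - 1)] for [y], hence for [x]. *)
rewrite -(@prednK (2 ^ k)) ?expn_gt0 //; apply: point_size_geq.
apply: leq_trans (pell_geq Y0 p).
by rewrite -(@leq_pmul2l 2) // -expnS prednK ?expn_gt0.
Qed.

(** Optimality quantifies over all integer points, so least-number search on the
    sizes needs a classical decision. *)
Lemma minimal_size_optimal_exists (R : realType) d (I : instance d) :
  (exists x, optimal R I x) -> exists x, minimal_size_optimal R I x.
Proof.
case=> x0 opt0.
pose P n := `[< exists2 x, optimal R I x & point_size x = n >].
have exP : exists n, P n by exists (point_size x0); apply/asboolP; exists x0.
case: (ex_minnP exP) => n /asboolP[x optx <-] min_x.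
by exists x; split=> // y opty; apply: min_x; apply/asboolP; exists y.
Qed.

Theorem proposition1p5 (R : realType) :
  exists F : nat -> instance 4,
    (forall N : nat, exists n : nat, (N <= input_size (F n))%N) /\
    exists (c K : R) (s0 : nat),
      1 < c /\ 0 < K /\
      forall n : nat, exists x : 'cV[int]_2,
        minimal_size_optimal R (F n) x /\
        ((s0 <= input_size (F n))%N ->
         K * c ^+ input_size (F n) <= (point_size x)%:R).
Proof.
exists pell_instance; split=> [N|].
  by exists N; rewrite input_size_pell_instance; lia.
exists (11 / 10), (1 / 8), 0%N; split; [lra | split; [lra | move=> k]].
have [|x minx] := @minimal_size_optimal_exists R _ (pell_instance k) _.
  have [x hx] := pell_instance_point k.
  by exists x; apply/optimal_pell_instance.
exists x; split=> // _; rewrite input_size_pell_instance.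
apply: le_trans (exp_input_size_bound R k) _; rewrite -natrX ler_nat.
by have [optx _] := minx; apply: optimal_pell_instance_size optx.
Qed.
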